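(* Let $\gamma>1$ and $\theta_n=e^{-n^\gamma}$ for $n\ge1$. Then for every fixed $j\ge1$, as $n\to\infty$, \[ \mathbb{E}_n(R_j)=\exp\Bigl\{j\gamma\Bigl(\frac{\log n}{\gamma-1}\Bigr)^{\frac{\gamma-1}{\gamma}}+o\Bigl((\log n)^{\frac{\gamma-1}{\gamma}}\Bigr)\Bigr\}. \]
   Context: For $\sigma\in\mathcal{S}_n$ (permutations of $\{1,\dots,n\}$), $R_j(\sigma)$ is the number of cycles of length $j$. Given parameters $\theta_j\ge0$, $h_n=\frac1{n!}\sum_{\sigma\in\mathcal{S}_n}\prod_j\theta_j^{R_j(\sigma)}$ and $\mathbb{P}_n(\sigma)=\frac1{n!h_n}\prod_j\theta_j^{R_j(\sigma)}$, with expectation $\mathbb{E}_n$. *)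

(* Defs.v *)
From mathcomp Require Import all_boot all_fingroup.
From Stdlib Require Import Reals.
Set Implicit Arguments. Unset Strict Implicit. Unset Printing Implicit Defensive.

(* R_j(sigma): number of cycles of length j of sigma (fixed points are the
   cycles of length 1; porbits s is the set of all cycles of s). *)
Definition cyc_count (n j : nat) (s : 'S_n) : nat :=
  #|[set c in porbits s | #|c| == j]|.

(* weight(sigma) = prod_{j=1}^{n} theta_j ^ R_j(sigma)  (R_j = 0 for j > n) *)
Definition perm_weight (theta : nat -> R) (n : nat) (s : 'S_n) : R :=
  \big[Rmult/R1]_(1 <= j < n.+1) (theta j ^ cyc_count j s)%R.

Definition h_n (theta : nat -> R) (n : nat) : R :=
  (/ INR (n`!) * \big[Rplus/R0]_(s : 'S_n) perm_weight theta s)%R.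

Definition Pn (theta : nat -> R) (n : nat) (s : 'S_n) : R :=
  (perm_weight theta s / (INR (n`!) * h_n theta n))%R.

Definition En_R (theta : nat -> R) (n j : nat) : R :=
  \big[Rplus/R0]_(s : 'S_n) (Pn theta s * INR (cyc_count j s))%R.

Definition theta_gamma (gamma : R) (k : nat) : R :=
  exp (- Rpower (INR k) gamma).

(* Main.v *)
(* Write [theta_k = exp (- k ^ gamma)] and let [a_n] (which is [h_n]) be the
   coefficients of [exp (\sum_(k >= 1) theta_k / k * z ^ k)], that is, [a_0 = 1] and
   [n * a_n = \sum_(1 <= k <= n) theta_k * a_(n-k)].  Then
   [E_n (R_j) = theta_j / j * a_(n-j) / a_n].  Since [1, theta_1, theta_2, ...] is
   log-concave, so is [a] (Bender and Canfield), hence [r_n = a_n / a_(n+1)] is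
   nondecreasing.  Monotonicity turns the recurrence into the two bounds
   [theta_k * r_n ^ k <= n + k] and [n + 1 <= \sum_k theta_k * r_n ^ k], which pin
   down [ln r_n] to leading order without a saddle point analysis: the first with
   [k] close to [(ln n / (gamma - 1)) ^ (1 / gamma)], the second through the
   tangent line of the convex function [t ^ gamma] at that point. *)
From mathcomp Require Import all_boot all_order all_algebra all_fingroup.
From mathcomp Require Import Rstruct.
Require Import Defs.
From Stdlib Require Import Reals Lra.
Set Implicit Arguments. Unset Strict Implicit. Unset Printing Implicit Defensive.
Import Order.TTheory GRing.Theory Num.Theory.
Delimit Scope nat_scope with N.
Delimit Scope ring_scope with RR.

(** * Inserting a fixed point of a permutation into another cycle *)

Section Insertion.

Variable T : finType.
Implicit Types (s : {perm T}) (A : {set T}).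

Lemma porbit_sub_stable s A z :
  z \in A -> (forall w, w \in A -> s w \in A) -> porbit s z \subset A.
Proof.
move=> zA sA; apply/subsetP => _ /porbitP[i ->].
by elim: i => [|i IHi]; rewrite ?perm1 // expgSr permM sA.
Qed.

Lemma porbit_fixed s x : s x = x -> porbit s x = [set x].
Proof.
move=> sx; apply/eqP; rewrite eqEsubset sub1set porbit_id andbT.
by apply: porbit_sub_stable => [|w]; rewrite !inE // => /eqP->; rewrite sx.
Qed.

Lemma mem_porbit_perm s x w : (s w \in porbit s x) = (w \in porbit s x).
Proof. by rewrite -!eq_porbit_mem (porbit_perm s 1). Qed.

Variables (s : {perm T}) (x y : T).
Hypotheses (sx : s x = x) (yx : y != x).
(** Products compose left to right, so this splices the fixed point [x] into the cycle of [y], just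
    before [y]. *)
Let t := (s * tperm x y)%g.

Lemma insert_perm_x : t x = y.
Proof. by rewrite permM sx tpermL. Qed.

Lemma insert_perm_y w : s w = y -> t w = x.
Proof. by move=> sw; rewrite permM sw tpermR. Qed.

Lemma insert_perm_neq w : w != x -> s w != y -> t w = s w.
Proof.
move=> wx wy; rewrite permM tpermD // eq_sym //.
by apply: contra wx => /eqP swx; apply/eqP/(@perm_inj _ s); rewrite swx.
Qed.

Lemma porbit_insert_sub w : porbit s w \subset porbit t w.
Proof.
apply: porbit_sub_stable => [|z zw]; first exact: porbit_id.
have [zx | zx] := eqVneq z x; first by rewrite zx sx -zx.
have [szy | szy] := eqVneq (s z) y; last first.
  by rewrite -(insert_perm_neq zx szy) mem_porbit_perm.
by rewrite szy -insert_perm_x mem_porbit_perm -(insert_perm_y szy) mem_porbit_perm.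
Qed.

Lemma porbit_insert_new : porbit t x = x |: porbit s y.
Proof.
apply/eqP; rewrite eqEsubset subUset sub1set porbit_id /= andbC.
rewrite (subset_trans (porbit_insert_sub y)) /=; last first.
  have: y \in porbit t x by rewrite -insert_perm_x mem_porbit_perm porbit_id.
  by rewrite -eq_porbit_mem => /eqP->.
apply: porbit_sub_stable => [|w]; first by rewrite setU11.
rewrite !in_setU1 => /predU1P[->|wy].
  by rewrite insert_perm_x porbit_id orbT.
have [-> | wx] := eqVneq w x; first by rewrite insert_perm_x porbit_id orbT.
have [swy | swy] := eqVneq (s w) y; first by rewrite (insert_perm_y swy) eqxx.
by rewrite (insert_perm_neq wx swy) mem_porbit_perm wy orbT.
Qed.

Lemma porbit_insert_old w : w \notin x |: porbit s y -> porbit t w = porbit s w.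
Proof.
rewrite in_setU1 negb_or => /andP[wx wy].
apply/eqP; rewrite eqEsubset porbit_insert_sub andbT.
apply: porbit_sub_stable => [|z zw]; first exact: porbit_id.
have zx : z != x.
  by apply: contraNneq wx => zx; move: zw; rewrite porbit_sym zx (porbit_fixed sx) inE.
have szy : s z != y.
  by apply: contraNneq wy => <-; rewrite porbit_sym mem_porbit_perm.
by rewrite (insert_perm_neq zx szy) mem_porbit_perm.
Qed.

Lemma notin_porbit_fixed : x \notin porbit s y.
Proof. by rewrite porbit_sym porbit_fixed // inE. Qed.

Lemma card_porbit_insert : #|porbit t x| = #|porbit s y|.+1.
Proof. by rewrite porbit_insert_new cardsU1 notin_porbit_fixed. Qed.

End Insertion.

Lemma perm_onD1 (T : finType) (s : {perm T}) (A : {set T}) x :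
  perm_on (A :\ x) s = perm_on A s && (s x == x).
Proof.
apply/subsetP/andP => [sA|[/subsetP sA /eqP sx] w].
  split; first by apply/subsetP => w /sA; rewrite inE => /andP[].
  by apply/negPn/negP => /sA; rewrite !inE eqxx.
move=> sw; rewrite !inE sA // andbT.
by apply: contraNneq sw => ->; rewrite sx.
Qed.

(** * Weighted sums over the permutations of a set *)

Section CycleSums.

Local Open Scope ring_scope.
Variables (R : comPzRingType) (T : finType) (phi : nat -> R).
Implicit Types (s : {perm T}) (A : {set T}).

(** Weighting points rather than cycles gives a [j]-cycle the weight [phi j ^+ j], and splitting off
    a cycle only splits the index set. *)
Definition cycle_weight A s : R := \prod_(z in A) phi #|porbit s z|.

Definition perm_sum A : R := \sum_(s | perm_on A s) cycle_weight A s.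

(** The cycle through [x] is left unweighted, so it can be shortened point by point without changing
    the summand. *)
Definition marked_sum A x (j : nat) : R :=
  \sum_(s | perm_on A s && (#|porbit s x| == j)) cycle_weight (A :\: porbit s x) s.

Lemma marked_sum1 A x : marked_sum A x 1 = perm_sum (A :\ x).
Proof.
have fixE s : (#|porbit s x| == 1)%N = (s x == x).
  apply/cards1P/eqP => [[z xz]|sx]; last by exists x; exact: porbit_fixed.
  have: x \in porbit s x by exact: porbit_id.
  have: s x \in porbit s x by rewrite mem_porbit_perm porbit_id.
  by rewrite xz !inE => /eqP-> /eqP.
apply: eq_big => [s | s]; first by rewrite perm_onD1 fixE.
by rewrite fixE => /andP[_ /eqP sx]; rewrite (porbit_fixed sx).
Qed.

(* Splitting along [y = s x]: the permutation [s * tperm x y] fixes [x], and its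
   cycle through [y] is that of [s] with [x] removed. *)
Lemma marked_sumS A x (j : nat) : (0 < j)%N -> x \in A ->
  marked_sum A x j.+1 = \sum_(y in A :\ x) marked_sum (A :\ x) y j.
Proof.
move=> j0 xA; rewrite /marked_sum.
rewrite (partition_big (fun s => s x) (mem (A :\ x))) /=; last first.
  move=> s /andP[sA /eqP sj]; rewrite !inE perm_closed // xA andbT.
  apply/negP => /eqP /porbit_fixed sx; move: sj j0.
  by rewrite sx cards1 => -[<-].
apply: eq_bigr => y yA; have [yx yA'] := setD1P yA.
rewrite (reindex_inj (mulIg (tperm x y))) /=.
have tx s : ((s * tperm x y)%g x == y) = (s x == x).
  by rewrite permM (canF_eq (tpermK _ _)) tpermR.
have tA s : perm_on A (s * tperm x y)%g = perm_on A s.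
  have tA : perm_on A (tperm x y).
    apply: (subset_trans (tperm_on x y)).
    by apply/subsetP => z; rewrite !inE => /orP[]/eqP->.
  apply/idP/idP => sA; last exact: perm_onM.
  by have:= perm_onM sA tA; rewrite -mulgA tperm2 mulg1.
apply: eq_big => [s|s].
  rewrite tx tA perm_onD1 -!andbA; case: (perm_on A s) => //=.
  rewrite andbC; case: eqP => //= sx.
  by rewrite card_porbit_insert // eqSS.
rewrite tx => /andP[_ /eqP sx]; rewrite porbit_insert_new //.
rewrite setDDl; apply: eq_bigr => z /setDP[zA zn].
by rewrite porbit_insert_old.
Qed.


Lemma cycle_weight_marked A s x : x \in A -> perm_on A s ->
  cycle_weight A s = phi #|porbit s x| ^+ #|porbit s x| * cycle_weight (A :\: porbit s x) s.
Proof.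
move=> xA sA; rewrite /cycle_weight (big_setID (porbit s x)) /=; congr (_ * _).
have /setIidPr-> : porbit s x \subset A.
  by apply: porbit_sub_stable => // w; rewrite perm_closed.
rewrite -prodr_const; apply: eq_bigr => z.
by rewrite -eq_porbit_mem => /eqP->.
Qed.

Lemma sum_cycle_weight_marked A x (j : nat) : x \in A ->
  \sum_(s | perm_on A s && (#|porbit s x| == j)) cycle_weight A s =
  phi j ^+ j * marked_sum A x j.
Proof.
move=> xA; rewrite /marked_sum big_distrr /=; apply: eq_bigr => s /andP[sA /eqP <-].
exact: cycle_weight_marked.
Qed.

Lemma perm_sum_marked A x : x \in A ->
  perm_sum A = \sum_(j < #|A|) phi j.+1 ^+ j.+1 * marked_sum A x j.+1.
Proof.
move=> xA.
under eq_bigr do rewrite -sum_cycle_weight_marked //.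
have A0 : (0 < #|A|)%N by apply/card_gt0P; exists x.
have psub s : perm_on A s -> porbit s x \subset A.
  by move=> sA; apply: porbit_sub_stable => // w; rewrite perm_closed.
have pA s : perm_on A s -> (#|porbit s x|.-1 < #|A|)%N.
  move=> /psub/subset_leq_card; have := card_porbit_neq0 s x.
  by case: #|porbit s x|.
case Am: #|A| A0 pA => [//|m] _ pA.
rewrite /perm_sum (partition_big (fun s => inord #|porbit s x|.-1 : 'I_m.+1) predT) //=.
apply: eq_bigr => j _; apply: eq_bigl => s.
case sA: (perm_on A s) => //=; rewrite -val_eqE /= inordK ?pA //.
by rewrite -eqSS prednK // lt0n card_porbit_neq0.
Qed.

End CycleSums.

(** * Coefficients of the exponential of a power series *)

Section ExpCoef.

Local Open Scope ring_scope.
Variables (R : numFieldType) (theta : nat -> R).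

(** The list [a_n, ..., a_0]: keeping all earlier values makes the course-of-values recursion
    structural. *)
Fixpoint exp_coef_rev n : seq R :=
  if n is m.+1 then
    (n%:R^-1 * \sum_(k < n) theta k.+1 * (exp_coef_rev m)`_k) :: exp_coef_rev m
  else [:: 1].

(* The coefficient of [z ^ n] in [exp (\sum_(k >= 1) theta k / k * z ^ k)]. *)
Definition exp_coef n : R := head 0 (exp_coef_rev n).

Lemma exp_coef0 : exp_coef 0 = 1. Proof. by []. Qed.

Lemma nth_exp_coef_rev n k : (k <= n)%N -> (exp_coef_rev n)`_k = exp_coef (n - k).
Proof.
elim: n k => [|n IHn] [|k] //= kn.
by rewrite subSS IHn.
Qed.

Lemma exp_coefS n :
  n.+1%:R * exp_coef n.+1 = \sum_(k < n.+1) theta k.+1 * exp_coef (n - k).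
Proof.
rewrite /exp_coef /= mulVKf ?pnatr_eq0 //.
by apply: eq_bigr => k _; rewrite nth_exp_coef_rev // -ltnS.
Qed.

Lemma exp_coef_gt0 n : (forall k, 0 < theta k.+1) -> 0 < exp_coef n.
Proof.
move=> th0; elim/ltn_ind: n => -[|n] IHn; first by rewrite exp_coef0 ltr01.
have: 0 < n.+1%:R * exp_coef n.+1.
  rewrite exp_coefS big_ord_recl ltr_pwDl ?mulr_gt0 ?IHn ?ltnS ?leq_subr //.
  by apply: sumr_ge0 => k _; rewrite mulr_ge0 ?ltW ?IHn ?ltnS ?leq_subr.
by rewrite pmulr_rgt0 ?ltr0Sn.
Qed.

End ExpCoef.

(** * Permutation sums in terms of the coefficients *)

Section PermSum.

Local Open Scope ring_scope.
Variables (R : numFieldType) (T : finType) (phi : nat -> R).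
Let a := exp_coef (fun k => phi k ^+ k).

(** The successive choices of the next point on the cycle and the factorial for the remaining
    [m - j] points multiply to [m!]. The hypothesis stops at size [m] so that the induction of
    [perm_sumE] can supply it. *)
Lemma marked_sum_rec m (A : {set T}) x j :
    (forall B : {set T}, (#|B| <= m)%N -> perm_sum phi B = #|B|`!%:R * a #|B|) ->
  x \in A -> #|A| = m.+1 -> (j <= m)%N ->
  marked_sum phi A x j.+1 = m`!%:R * a (m - j).
Proof.
elim: j m A x => [|j IHj] m A x IH xA Am jm.
all: have Axm : #|A :\ x| = m by move: Am; rewrite (cardsD1 x) xA add1n => -[].
  by rewrite marked_sum1 IH Axm // subn0.
rewrite marked_sumS //.
case: m jm IH Am Axm => // m jm IH Am Axm.
rewrite (eq_bigr (fun _ => m`!%:R * a (m - j))) => [|y yA]; last first.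
  by apply: IHj => // B Bm; apply: IH; apply: leqW.
by rewrite sumr_const Axm factS natrM subSS -[LHS]mulr_natl mulrA.
Qed.

(** Strong induction on the size: sorting by the length of the cycle through one point yields the
    recurrence of [exp_coef]. *)
Lemma perm_sumE (A : {set T}) : perm_sum phi A = #|A|`!%:R * a #|A|.
Proof.
have [m] := ubnP #|A|; elim: m A => // m IHm A; rewrite ltnS.
case Am: #|A| => [|n] nm.
  rewrite (cards0_eq Am) /a exp_coef0 mulr1 /perm_sum (big_pred1 1%g) => [|s].
    by rewrite /cycle_weight big_set0.
  apply/idP/eqP => [/perm_on_id-> //|->]; last exact: perm_on1.
  by rewrite cards0.
have /card_gt0P[x xA] : (0 < #|A|)%N by rewrite Am.
rewrite (perm_sum_marked _ xA) Am factS natrM mulrAC exp_coefS mulrC.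
rewrite mulr_sumr; apply: eq_bigr => k _.
have -> : marked_sum phi A x k.+1 = n`!%:R * a (n - k).
  apply: marked_sum_rec => //; last by rewrite -ltnS.
  by move=> B Bn; apply: IHm; apply: leq_trans nm.
by rewrite mulrCA.
Qed.

Lemma marked_sumE m (A : {set T}) x j : x \in A -> #|A| = m.+1 -> (j <= m)%N ->
  marked_sum phi A x j.+1 = m`!%:R * a (m - j).
Proof. by apply: marked_sum_rec => B _; apply: perm_sumE. Qed.

End PermSum.

(** * Expected number of cycles of a given length *)

Lemma card_porbit_eq n (s : 'S_n) j :
  #|[set x | #|porbit s x| == j]| = (cyc_count j s * j)%N.
Proof.
apply: (card_uniform_partition (n := j)) => [c|]; first by rewrite inE => /andP[_ /eqP].
apply/and3P; split.
- apply/eqP/setP => x; apply/bigcupP/idP => [[c]|].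
    rewrite !inE => /andP[/imsetP[y _ ->] /eqP cj].
    by rewrite -eq_porbit_mem => /eqP->; rewrite cj.
  rewrite inE => xj; exists (porbit s x); last exact: porbit_id.
  by rewrite inE xj imset_f.
- apply/trivIsetP => c d; rewrite !inE => /andP[/imsetP[x _ ->] _] /andP[/imsetP[y _ ->] _] xy.
  apply/pred0P => z /=; apply: contraNF xy => /andP[].
  by rewrite -!eq_porbit_mem => /eqP-> /eqP->.
- rewrite inE negb_and; apply/orP; left; apply/imsetP => -[x _] /setP/(_ x).
  by rewrite inE porbit_id.
Qed.

Section Expectation.

Local Open Scope ring_scope.
Variables (R : numFieldType) (phi : nat -> R) (n : nat).
Let a := exp_coef (fun k => phi k ^+ k).

Lemma cycle_weight_setT (s : 'S_n) :
  cycle_weight phi [set: 'I_n] s = \prod_(1 <= j < n.+1) (phi j ^+ j) ^+ cyc_count j s.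
Proof.
rewrite big_add1 /= big_mkord.
have pn x : (#|porbit s x|.-1 < n)%N.
  have := max_card (mem (porbit s x)); rewrite card_ord; have := card_porbit_neq0 s x.
  by case: #|porbit s x|.
rewrite /cycle_weight (partition_big (fun x => Ordinal (pn x)) predT) //=.
apply: eq_bigr => j _; rewrite -exprM mulnC -card_porbit_eq -prodr_const.
apply: eq_big => [x|x].
  by rewrite !inE -val_eqE /= -eqSS prednK // lt0n card_porbit_neq0.
by rewrite !inE -val_eqE /= => /eqP<-; rewrite prednK // lt0n card_porbit_neq0.
Qed.

Lemma sum_cycle_weight :
  \sum_(s : 'S_n) cycle_weight phi [set: 'I_n] s = n`!%:R * a n.
Proof.
have := perm_sumE phi [set: 'I_n]; rewrite cardsT card_ord => <-.
by apply: eq_bigl => s; apply/esym/subsetP => x; rewrite !inE.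
Qed.

(** Since [j] times the cycle count is the number of points on [j]-cycles, exchanging the sums
    leaves one marked sum per point, all equal. *)
Lemma sum_cycle_weight_count j : (0 < j <= n)%N ->
  \sum_(s : 'S_n) cycle_weight phi [set: 'I_n] s * (cyc_count j s)%:R =
  n`!%:R * (phi j ^+ j / j%:R * a (n - j)).
Proof.
case: j => // j /= jn.
apply: (@mulIf _ j.+1%:R); first by rewrite pnatr_eq0.
rewrite mulr_suml.
under eq_bigr => s _ do
  rewrite -mulrA -natrM -card_porbit_eq -sum1dep_card natr_sum mulr_sumr.
rewrite (exchange_big_dep predT) //=.
case: n jn => // m jm.
rewrite (eq_bigr (fun _ => phi j.+1 ^+ j.+1 * (m`!%:R * a (m - j)))) => [|x _].
  rewrite sumr_const card_ord subSS factS natrM -[LHS]mulr_natl -!mulrA.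
  congr (_ * _); rewrite mulrCA; congr (_ * (_ * _)).
  by rewrite [RHS]mulrC mulfK ?pnatr_eq0.
rewrite -(marked_sumE phi (in_setT x)) ?cardsT ?card_ord //.
rewrite -sum_cycle_weight_marked ?inE //.
apply: eq_big => [s|s _]; last by rewrite mulr1.
by rewrite andbC; case: eqP => //= _; apply/esym/subsetP => y; rewrite !inE.
Qed.

End Expectation.

(** * Chebyshev's sum inequality and log-concave sequences *)

Section LogConcavity.

Local Open Scope ring_scope.
Variable R : realFieldType.

(** Monotonicity of [q / p] and [c / b] is stated cross-multiplied, so that [c] may vanish. Twice
    the difference of the sides is a sum over pairs of products of two factors of equal sign. *)
Lemma chebyshev_sum_le n (p q b c : nat -> R) :
    (forall k l, (k <= l < n)%N -> p k * q l <= q k * p l) ->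
    (forall k l, (k <= l < n)%N -> b k * c l <= c k * b l) ->
  (\sum_(k < n) q k * b k) * (\sum_(k < n) p k * c k) <=
  (\sum_(k < n) p k * b k) * (\sum_(k < n) q k * c k).
Proof.
move=> pq bc; rewrite -subr_ge0 -(pmulrn_lge0 _ (ltn0Sn 1)) mulr2n.
set D := (X in X + X).
pose X k l := p k * b k * (q l * c l) - q k * b k * (p l * c l).
have DE : D = \sum_(k < n) \sum_(l < n) X k l.
  rewrite /D !big_distrlr /= -sumrB; apply: eq_bigr => k _.
  by rewrite -sumrB.
rewrite {2}DE exchange_big DE -big_split; apply: sumr_ge0 => k _.
rewrite -big_split; apply: sumr_ge0 => l _ /=.
have -> : X k l + X l k = (p k * q l - q k * p l) * (b k * c l - c k * b l).
  rewrite /X [p k * _ * _]mulrACA [q k * _ * _]mulrACA [p l * _ * _]mulrACA.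
  rewrite [q l * _ * _]mulrACA (mulrC (p l)) (mulrC (q l)) (mulrC (b l)) -!mulrBl.
  by rewrite mulrBr -[q k * p l - _]opprB mulNr.
have [kl|/ltnW lk] := leqP k l.
  by apply: mulr_le0; rewrite subr_le0 ?pq ?bc // kl ltn_ord.
by apply: mulr_ge0; rewrite subr_ge0 mulrC [leRHS]mulrC ?pq ?bc // lk ltn_ord.
Qed.

Variables (u : nat -> R).
Hypothesis u0 : forall k, 0 < u k.

(** Log-concavity is assumed only up to [n], so that this applies inside the induction proving it
    for [a]. *)
Lemma log_concave_ratio n k l :
    (forall i, (i.+2 <= n)%N -> u i * u i.+2 <= u i.+1 * u i.+1) ->
  (k <= l < n)%N -> u k * u l.+1 <= u k.+1 * u l.
Proof.
move=> lc /andP[]; elim: l => [|l IHl].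
  by rewrite leqn0 => /eqP-> _; rewrite mulrC.
rewrite leq_eqVlt => /predU1P[-> _|]; first by rewrite mulrC.
rewrite ltnS => kl ln; have {IHl} := IHl kl (ltnW ln) => IH.
rewrite -(ler_pM2r (u0 l)) -mulrA [u l.+2 * _]mulrC.
apply: le_trans (_ : u k * (u l.+1 * u l.+1) <= _).
  by rewrite ler_pM2l ?lc.
by rewrite mulrA [leRHS]mulrAC ler_pM2r.
Qed.


End LogConcavity.

(** * Log-concavity of the coefficients and bounds on their ratios *)

Section ExpCoefLogConcave.

Local Open Scope ring_scope.
Variables (R : realFieldType) (theta : nat -> R).
Hypotheses (theta0 : theta 0 = 1) (theta_gt0 : forall k, 0 < theta k).
Hypothesis theta_lc : forall k, theta k * theta k.+2 <= theta k.+1 * theta k.+1.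
Let a := exp_coef theta.
Let a0 n : 0 < a n. Proof. exact: exp_coef_gt0. Qed.

(** The convention [theta 0 = 1] adds one more [a n] to the recurrence, turning the factor [n] into
    [n + 1]. *)
Lemma exp_coef_conv n : n.+1%:R * a n = \sum_(k < n.+1) theta k * a (n - k).
Proof.
rewrite big_ord_recl theta0 mul1r subn0.
case: n => [|n]; first by rewrite big_ord0 addr0 mul1r.
by rewrite -natr1 mulrDl mul1r addrC exp_coefS.
Qed.

(* Chebyshev's inequality for the weights [theta k * a (n.+1 - k)], with the
   nonincreasing factors [theta k.+1 / theta k] and [a (n - k) / a (n.+1 - k)]:
   all four sums are evaluated by the convolution recurrence. *)
Lemma exp_coef_log_concave n : a n * a n.+2 <= a n.+1 * a n.+1.
Proof.
elim/ltn_ind: n => n IHn.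
(* Extension by zero puts all four sums on [n + 2] indices; truncated subtraction would give
   [a 0 = 1] at [k = n + 1]. *)
pose c k := if (k < n.+1)%N then a (n - k) else 0.
have cE (v : nat -> R) : \sum_(k < n.+2) v k * c k = \sum_(k < n.+1) v k * a (n - k).
  rewrite big_ord_recr /= /c ltnn mulr0 addr0.
  by apply: eq_bigr => k _; rewrite ltn_ord.
have := @chebyshev_sum_le _ n.+2 theta (fun k => theta k.+1) (fun k => a (n.+1 - k)) c.
rewrite (cE theta) (cE (fun k => theta k.+1)) /= -!exp_coefS -!exp_coef_conv => cheb.
have {cheb}: n.+2%:R * a n.+2 * (n.+1%:R * a n) <= n.+2%:R * a n.+1 * (n.+1%:R * a n.+1).
  apply: cheb => k l /andP[kl ln].
    by apply: (@log_concave_ratio _ theta _ l.+1); rewrite ?kl //=.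
  rewrite /c; case: (ltnP l n.+1) => ln'; last first.
    by rewrite mulr0; case: ifP => _; rewrite ?mul0r // mulr_ge0 // ltW.
  rewrite ltnS in ln'; have kn := leq_trans kl ln'.
  rewrite ltnS kn mulrC !subSn // [leRHS]mulrC.
  apply: (@log_concave_ratio _ a _ n.+1) => //.
  by rewrite leq_sub2l // ltnS leq_subr.
by rewrite [leLHS]mulrACA [leRHS]mulrACA ler_pM2l ?mulr_gt0 ?ltr0Sn // [leLHS]mulrC.
Qed.

Definition exp_coef_ratio n := a n / a n.+1.

Local Notation r := exp_coef_ratio.

Lemma exp_coef_ratio_gt0 n : 0 < r n.
Proof. exact: divr_gt0. Qed.

Lemma exp_coef_ratio_le k l : (k <= l)%N -> r k <= r l.
Proof.
move=> kl; rewrite ler_pdivrMr // mulrAC ler_pdivlMr // [leRHS]mulrC.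
by apply: (@log_concave_ratio _ a _ l.+1) => // [i _|]; rewrite ?kl /= ?exp_coef_log_concave.
Qed.

(** The quotient [a m / a (m + j)] telescopes into [j] ratios, each at least [r l] by
    monotonicity. *)
Lemma exp_coef_ratio_lower l m j : (l <= m)%N -> r l ^+ j * a (m + j) <= a m.
Proof.
move=> lm; elim: j => [|j IHj]; first by rewrite mul1r addn0.
apply: le_trans IHj; rewrite exprSr -mulrA ler_pM2l ?exprn_gt0 ?exp_coef_ratio_gt0 //.
rewrite addnS -ler_pdivlMr //.
by apply: exp_coef_ratio_le; apply: leq_trans lm (leq_addr _ _).
Qed.

Lemma exp_coef_ratio_upper l m j : (m + j <= l.+1)%N -> a m <= r l ^+ j * a (m + j).
Proof.
elim: j => [|j IHj] ml; first by rewrite mul1r addn0.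
apply: le_trans (IHj _) _; first by apply: leq_trans ml; rewrite leq_add2l.
rewrite exprSr -mulrA ler_pM2l ?exprn_gt0 ?exp_coef_ratio_gt0 //.
rewrite addnS -ler_pdivrMr //.
by apply: exp_coef_ratio_le; rewrite -ltnS -addnS.
Qed.

(** Only the term [theta k * a n] of the recurrence for [a (n + k)] is kept. *)
Lemma theta_ratio_le n k : (0 < k)%N -> theta k * r n ^+ k <= (n + k)%:R.
Proof.
case: k => // k _; rewrite -(ler_pM2r (a0 (n + k.+1))) -mulrA.
apply: le_trans (_ : theta k.+1 * a n <= _).
  by rewrite ler_pM2l // exp_coef_ratio_lower.
have kn : (k < (n + k).+1)%N by rewrite ltnS leq_addl.
rewrite addnS exp_coefS (bigD1 (Ordinal kn)) //= addnK lerDl.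
by apply: sumr_ge0 => i _; rewrite mulr_ge0 // ltW.
Qed.

Lemma sum_theta_ratio_ge n : n.+1%:R <= \sum_(k < n.+1) theta k.+1 * r n ^+ k.+1.
Proof.
rewrite -(ler_pM2r (a0 n.+1)) exp_coefS mulr_suml; apply: ler_sum => k _.
rewrite -mulrA ler_pM2l //.
have kn : (k <= n)%N by rewrite -ltnS.
have := @exp_coef_ratio_upper n (n - k) k.+1.
by rewrite addnS subnK // => ->.
Qed.

End ExpCoefLogConcave.

Section RealExpectation.

Local Open Scope ring_scope.

Lemma En_R_exp_coef (theta phi : nat -> R) n j :
    (forall k, (0 < k)%N -> theta k = phi k ^+ k) ->
    exp_coef (fun k => phi k ^+ k) n != 0 -> (0 < j <= n)%N ->
  En_R theta n j =
  theta j / j%:R *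
    (exp_coef (fun k => phi k ^+ k) (n - j) / exp_coef (fun k => phi k ^+ k) n).
Proof.
set a := exp_coef _ => thE an0 jn.
have wE (s : 'S_n) : perm_weight theta s = cycle_weight phi [set: 'I_n] s.
  rewrite cycle_weight_setT /perm_weight; apply: eq_big_nat => k /andP[k0 _].
  by rewrite RpowE thE.
have n0 : n`!%:R != 0 :> R by rewrite pnatr_eq0 -lt0n fact_gt0.
have hE : h_n theta n = a n.
  rewrite /h_n (eq_bigr _ (fun s _ => wE s)) INRE.
  by rewrite [X in Rmult _ X](sum_cycle_weight phi n); apply: mulKf.
rewrite /En_R /Pn hE INRE.
have -> : \big[Rplus/R0]_(s : 'S_n)
     (perm_weight theta s / (n`!%:R * a n) * INR (cyc_count j s))%R =
   (n`!%:R * a n)^-1 * \sum_(s : 'S_n) cycle_weight phi [set: 'I_n] s * (cyc_count j s)%:R.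
  rewrite mulr_sumr; apply: eq_bigr => s _.
  by rewrite wE INRE RdivE RmultE [LHS]mulrAC mulrC.
rewrite sum_cycle_weight_count // thE; last by case/andP: jn.
by rewrite -/a invfM mulrC mulrACA mulfV // mul1r mulrA.
Qed.

End RealExpectation.

(** * Convexity estimates for real powers *)

Section RealPower.

Local Open Scope R_scope.

Lemma ln_le x y : 0 < x -> x <= y -> ln x <= ln y.
Proof. by move=> x0 [xy|->]; [left; apply: ln_increasing | right]. Qed.

Lemma nat_ceil x : 1 <= x -> exists k : nat, (0 < k)%N /\ x <= INR k <= x + 1.
Proof.
move=> x1; have [up1 up2] := archimed x.
have up0 : (0 <= up x)%Z by apply: le_IZR; lra.
have [k kE] := IZN _ up0; exists k.
have e : INR k = IZR (up x) by rewrite kE INR_IZR_INZ.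
split; last by rewrite e; lra.
by apply/ssrnat.ltP; apply: INR_lt; rewrite e /=; lra.
Qed.

(** With [x / y = exp v], division by [y ^ g * exp v] leaves [g <= exp ((g - 1) * v) + (g - 1) * exp
    (- v)], which follows from [1 + t <= exp t] used twice. *)
Lemma Rpower_tangent g x y : 1 < g -> 0 < x -> 0 < y ->
  g * x * Rpower y (g - 1) - (g - 1) * Rpower y g <= Rpower x g.
Proof.
move=> g1 x0 y0; set v := ln x - ln y; set P := exp (g * ln y).
have P0 : 0 < P by exact: exp_pos.
have e1 : Rpower x g = exp ((g - 1) * v) * exp v * P.
  by rewrite /Rpower /P -!exp_plus /v; f_equal; ring.
have e2 : x * Rpower y (g - 1) = exp v * P.
  by rewrite /Rpower /P -{1}(exp_ln x x0) -!exp_plus /v; f_equal; ring.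
rewrite Rmult_assoc e2 e1 -/P -[Rpower y g]/P.
have h1 := exp_ineq1_le ((g - 1) * v).
have h2 := exp_ineq1_le (- v).
have h3 : exp v * exp (- v) = 1 by rewrite -exp_plus Rplus_opp_r exp_0.
have v0 := exp_pos v.
have h4 : g - exp ((g - 1) * v) <= (g - 1) * exp (- v) by nra.
have h5 : exp v * (g - exp ((g - 1) * v)) <= g - 1 by nra.
nra.
Qed.

Lemma Rpower_midpoint g k : 1 < g ->
  2 * Rpower (INR k.+2) g <= Rpower (INR k.+1) g + Rpower (INR k.+3) g.
Proof.
move=> g1.
have p m : 0 < INR m.+1 by apply: lt_0_INR; apply/ssrnat.ltP.
have h1 := Rpower_tangent g1 (p k) (p k.+1).
have h2 := Rpower_tangent g1 (p k.+2) (p k.+1).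
have e : INR k.+2 * Rpower (INR k.+2) (g - 1) = Rpower (INR k.+2) g.
  by rewrite -{1}(Rpower_1 _ (p k.+1)) -Rpower_plus; f_equal; ring.
rewrite !S_INR in h1 h2 e p *.
nra.
Qed.

(** Indeed [(1 + 1 / x) ^ c <= exp (c / x) <= 1 + eta]. This later absorbs the rounding of the
    dominant index to an integer. *)
Lemma Rpower_add1_le x c eta : 0 < x -> 0 < c -> 0 < eta -> c <= x * ln (1 + eta) ->
  Rpower (x + 1) c <= (1 + eta) * Rpower x c.
Proof.
move=> x0 c0 eta0 h.
have -> : x + 1 = (1 + / x) * x by field; lra.
have ix0 : 0 < / x by exact: Rinv_0_lt_compat.
rewrite -Rpower_mult_distr; [|lra|lra].
apply: Rmult_le_compat_r; first by left; exact: exp_pos.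
rewrite -[1 + eta]exp_ln; last lra.
have lnx : ln (1 + / x) <= / x.
  rewrite -[X in _ <= X]ln_exp; apply: ln_le; first lra.
  exact: exp_ineq1_le.
have : c * ln (1 + / x) <= ln (1 + eta).
  apply: (@Rle_trans _ (c * / x)); first by apply: Rmult_le_compat_l; lra.
  apply: (Rmult_le_reg_l x) => //.
  have -> : x * (c * / x) = c by field; lra.
  exact: h.
by case=> [xy|e]; [left; apply: exp_increasing | right; rewrite /Rpower e].
Qed.

End RealPower.

Lemma sum_half_pow_lt1 (F : numFieldType) n :
  (\sum_(k < n) 2^-1 ^+ k.+1 < 1 :> F)%RR.
Proof.
suff -> : (\sum_(k < n) 2^-1 ^+ k.+1 = 1 - 2^-1 ^+ n :> F)%RR.
  by rewrite ltrBlDr ltrDl exprn_gt0 // invr_gt0 ltr0n.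
elim: n => [|n IHn]; first by rewrite big_ord0 expr0 subrr.
rewrite big_ord_recr /= IHn -addrA; congr (_ + _)%RR.
have -> : (2^-1 ^+ n = 2^-1 ^+ n.+1 + 2^-1 ^+ n.+1 :> F)%RR.
  by rewrite -mulr2n exprS -mulrnAl -[(_^-1 *+ 2)%RR]mulr_natr mulVf ?mul1r // pnatr_eq0.
by rewrite opprD addrNK.
Qed.

(** * Two-sided bounds on [ln (r n)] for the parameters [exp (- k ^ gamma)] *)

Section ThetaGamma.

Local Open Scope R_scope.
Variables (gamma : R) (gamma1 : 1 < gamma).

(* A [k]-th root of [theta_gamma gamma k]; its zeroth power supplies the value
   [1] at [k = 0] for which the sequence of parameters is log-concave. *)
Definition theta_root (k : nat) : R := exp (- (Rpower (INR k) gamma / INR k)).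

Let theta (k : nat) : R := (theta_root k ^+ k)%RR.

Lemma theta_rootE k : (0 < k)%N -> theta_gamma gamma k = (theta_root k ^+ k)%RR.
Proof.
move=> k0; rewrite expRX -mulr_natr -INRE -RmultE /theta_gamma; f_equal.
have k0' : INR k <> 0 by apply: not_0_INR => k0'; rewrite k0' in k0.
by field.
Qed.

Let theta0 : theta 0 = 1%RR. Proof. by []. Qed.

Let thetaS k : theta k.+1 = exp (- Rpower (INR k.+1) gamma).
Proof. by rewrite -[RHS]/(theta_gamma gamma k.+1) theta_rootE. Qed.

Lemma theta_root_pow_gt0 k : (0 < theta_root k ^+ k)%RR.
Proof. by apply: exprn_gt0; apply/RltP; apply: exp_pos. Qed.

Lemma theta_root_pow_log_concave k : (theta k * theta k.+2 <= theta k.+1 * theta k.+1)%RR.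
Proof.
have le_exp x y : x <= y -> exp x <= exp y.
  by case=> [xy|->]; [left; apply: exp_increasing | right].
apply/RleP; case: k => [|k].
  (* The case [k = 0] amounts to [2 <= 2 ^ gamma], given by the tangent at [1]. *)
  rewrite theta0 mul1r !thetaS -RmultE -exp_plus; apply: le_exp.
  have := Rpower_tangent gamma1 Rlt_0_2 Rlt_0_1.
  rewrite /Rpower ln_1 !Rmult_0_r exp_0 -/(Rpower _ _) /=.
  lra.
rewrite !thetaS -!RmultE -!exp_plus; apply: le_exp.
have := Rpower_midpoint k gamma1; lra.
Qed.

Let r := exp_coef_ratio theta.

Let r_gt0 n : 0 < r n.
Proof. apply/RltP; apply: exp_coef_ratio_gt0 => k; exact: theta_root_pow_gt0. Qed.

(** Take logarithms in [theta_k * r_n ^ k <= n + k <= (n + 1) * k] and divide by [k]; the summand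
    [1] covers [ln k / k]. *)
Lemma ln_ratio_le n k : (0 < k)%N ->
  ln (r n) <= ln (INR n.+1) / INR k + 1 + Rpower (INR k) (gamma - 1).
Proof.
case: k => // k _; set K := INR k.+1.
have K1 : 1 <= K by rewrite /K S_INR; have := pos_INR k; lra.
have N1 : 1 <= INR n.+1 by rewrite S_INR; have := pos_INR n; lra.
have h : K * ln (r n) - Rpower K gamma <= ln (INR n.+1) + ln K.
  rewrite -ln_mult; try lra.
  rewrite -{1}(ln_exp (K * ln (r n) - _)); apply: ln_le; first exact: exp_pos.
  apply: (@Rle_trans _ (INR (n + k.+1))); last first.
    by rewrite plus_INR -/K; rewrite S_INR in N1 *; nra.
  have /RleP := @theta_ratio_le _ theta theta0 theta_root_pow_gt0
    theta_root_pow_log_concave n k.+1 isT.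
  rewrite -/r -INRE thetaS -/K -RmultE -RpowE -(Rpower_pow _ _ (r_gt0 n)) -/K /Rpower.
  by rewrite -exp_plus; apply: Rle_trans; right; f_equal; rewrite /Rpower; ring.
have lnK : ln K <= K by have := exp_ineq1_le (ln K); rewrite exp_ln; lra.
have e : Rpower K gamma = K * Rpower K (gamma - 1).
  by rewrite -{2}(Rpower_1 K) -?Rpower_plus; [f_equal; ring | lra].
apply: (Rmult_le_reg_l K); first lra.
rewrite e in h.
have -> : K * (ln (INR n.+1) / K + 1 + Rpower K (gamma - 1)) =
  ln (INR n.+1) + K + K * Rpower K (gamma - 1) by field; lra.
lra.
Qed.

Lemma ln_ratio_ge n : (0 < n)%N ->
  gamma * Rpower (ln (INR n.+1) / (gamma - 1)) ((gamma - 1) / gamma) - 1 <= ln (r n).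
Proof.
move=> n0; set kap := Rpower (ln (INR n.+1) / (gamma - 1)) (/ gamma).
have N1 : 1 < INR n.+1.
  by rewrite -[1]/(INR 1); apply: lt_INR; apply/ssrnat.ltP.
have L0 : 0 < ln (INR n.+1) by rewrite -ln_1; apply: ln_increasing; lra.
have kap0 : 0 < kap by exact: exp_pos.
have -> : Rpower (ln (INR n.+1) / (gamma - 1)) ((gamma - 1) / gamma) = Rpower kap (gamma - 1).
  by rewrite /kap Rpower_mult; f_equal; field; lra.
(* By the choice of [kap], the tangent at [kap] has intercept [- ln (n + 1)]. *)
have kapE : (gamma - 1) * Rpower kap gamma = ln (INR n.+1).
  rewrite /kap Rpower_mult Rinv_l; last lra.
  rewrite Rpower_1; first by field; lra.
  by apply: Rdiv_lt_0_compat; lra.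
(* With [x = r n], the tangent line of [t |-> t ^ gamma] at [kap] bounds each
   [theta k * (e * x) ^ k] by [n.+1], so that [\sum_k theta k * x ^ k < n.+1]. *)
apply: Rnot_lt_le => small.
have /RleP := @sum_theta_ratio_ge _ theta theta0 theta_root_pow_gt0
    theta_root_pow_log_concave n.
apply: Rlt_not_le; apply/RltP.
rewrite -[X in (_ < X)%RR]mulr1.
apply: le_lt_trans (_ : (n.+1%:R * \sum_(k < n.+1) 2^-1 ^+ k.+1 < _)%RR); last first.
  by rewrite ltr_pM2l ?ltr0Sn // sum_half_pow_lt1.
rewrite mulr_sumr; apply: ler_sum => k _; set K := INR k.+1.
have K0 : 0 < K by rewrite /K S_INR; have := pos_INR k; lra.
(* The [- 1] in the claim leaves a factor [exp (-1)], at most one half, per power. *)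
apply: le_trans (_ : (n.+1%:R * exp (Ropp 1) ^+ k.+1 <= _)%RR); last first.
  rewrite ler_pM2l ?ltr0Sn //; apply: lerXn2r; rewrite ?nnegrE.
  - by apply/RleP; left; apply: exp_pos.
  - by rewrite invr_ge0 ler0n.
  - have -> : (2^-1)%RR = / 2 :> R by rewrite -INRE.
    apply/RleP; rewrite exp_Ropp; apply: Rinv_le_contravar; first lra.
    by have := exp_ineq1_le 1; lra.
apply/RleP; rewrite -INRE thetaS -/K -/r -!RpowE -!RmultE.
rewrite -!Rpower_pow; [|exact: exp_pos|exact: r_gt0].
rewrite -[INR n.+1]exp_ln; last lra.
rewrite /Rpower ln_exp -!exp_plus -/K.
have := Rpower_tangent gamma1 K0 kap0; rewrite kapE /Rpower => tan.
have h : K * ln (r n) <= K * (gamma * exp ((gamma - 1) * ln kap) - 1).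
  by apply: Rmult_le_compat_l; move: small; rewrite /Rpower; lra.
have : - exp (gamma * ln K) + K * ln (r n) <= ln (INR n.+1) + K * Ropp 1 by nra.
by case=> [xy|->]; [left; apply: exp_increasing | right].
Qed.

Let beta := (gamma - 1) / gamma.
Let kappa (L : R) := Rpower (L / (gamma - 1)) (/ gamma).
(* [gamma * saddle (ln n)] is the logarithm of the approximate saddle point, and
   [kappa (ln n)] the index [k] of the dominant term there. *)
Let saddle (L : R) := Rpower (L / (gamma - 1)) beta.

Lemma kappa_saddle L : 0 < L -> kappa L * saddle L = L / (gamma - 1).
Proof.
move=> L0; rewrite /kappa /saddle /beta -Rpower_plus.
have -> : / gamma + (gamma - 1) / gamma = 1 by field; lra.
by rewrite Rpower_1 //; apply: Rdiv_lt_0_compat; lra.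
Qed.

Lemma kappa_pow L : Rpower (kappa L) (gamma - 1) = saddle L.
Proof. by rewrite /kappa /saddle /beta Rpower_mult; f_equal; field; lra. Qed.

(** With [k] the rounded-up [kappa], the two main terms of [ln_ratio_le] are at most
    [(gamma - 1) * saddle] and [(1 + eta) * saddle]. *)
Lemma ln_ratio_upper n eta : 0 < eta -> 0 < ln (INR n.+1) ->
    1 <= kappa (ln (INR n.+1)) -> gamma - 1 <= kappa (ln (INR n.+1)) * ln (1 + eta) ->
  ln (r n) <= (gamma + eta) * saddle (ln (INR n.+1)) + 1.
Proof.
set L := ln _ => eta0 L0 k1 k2.
have [k [k0 [kl ku]]] := nat_ceil k1.
have h := ln_ratio_le n k0; rewrite -/L in h.
have h1 : L / INR k <= (gamma - 1) * saddle L.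
  have -> : L = (gamma - 1) * (kappa L * saddle L).
    by rewrite kappa_saddle //; field; lra.
  rewrite {2}kappa_saddle // (_ : (gamma - 1) * (L / (gamma - 1)) = L); last by field; lra.
  have s0 : 0 < saddle L by exact: exp_pos.
  apply: (Rmult_le_reg_r (INR k)); first lra.
  rewrite /Rdiv Rmult_assoc Rinv_l ?Rmult_1_r; last lra.
  rewrite -!Rmult_assoc.
  have : 0 < (gamma - 1) * saddle L by nra.
  nra.
have h2 : Rpower (INR k) (gamma - 1) <= (1 + eta) * saddle L.
  rewrite -kappa_pow; apply: (@Rle_trans _ (Rpower (kappa L + 1) (gamma - 1))).
    by apply: Rle_Rpower_l; lra.
  by apply: Rpower_add1_le; lra.
lra.
Qed.

(** Here [ln (m + 1) >= L - 1]. As [beta < 1], lowering [L] by [1] costs at most [saddle L / L],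
    which is at most [1 / (gamma - 1)] when [kappa L >= 1]. *)
Lemma ln_ratio_lower n m : (0 < m)%N -> (n <= m.+1.*2)%N -> 2 <= ln (INR n) ->
    1 <= kappa (ln (INR n)) ->
  gamma * saddle (ln (INR n)) - gamma / (gamma - 1) - 1 <= ln (r m).
Proof.
set L := ln _ => m0 nm L2 k1.
apply: Rle_trans (ln_ratio_ge m0); apply: Rplus_le_compat_r.
have n0 : 0 < INR n.
  (* The convention [ln 0 = 0] contradicts [2 <= L]. *)
  case: n @L nm L2 k1 => [|n] L nm L2 k1; last by apply: lt_0_INR; apply/ssrnat.ltP.
  by move: L2; rewrite /L /= /ln; case: Rlt_dec => [/Rlt_irrefl|_] //; lra.
have Lm : L - 1 <= ln (INR m.+1).
  rewrite -[X in L - X]ln_exp.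
  have -> : L - ln (exp 1) = ln (INR n * / exp 1).
    rewrite ln_mult //; last by apply: Rinv_0_lt_compat; exact: exp_pos.
    by rewrite ln_Rinv //; exact: exp_pos.
  have e2 := exp_ineq1_le 1.
  have e0 := exp_pos 1.
  apply: ln_le; first by apply: Rmult_lt_0_compat => //; apply: Rinv_0_lt_compat.
  apply: (Rmult_le_reg_r (exp 1)) => //.
  rewrite Rmult_assoc Rinv_l ?Rmult_1_r; last lra.
  have : INR n <= INR (m.+1.*2) by apply: le_INR; apply/ssrnat.leP.
  rewrite -addnn plus_INR.
  have := pos_INR m.+1.
  nra.
have L0 : 0 < L by lra.
have s0 : 0 < saddle L by exact: exp_pos.
have b1 : 0 < beta < 1.
  split; first by apply: Rdiv_lt_0_compat; lra.
  by apply: (Rmult_lt_reg_r gamma); rewrite /beta /Rdiv ?Rmult_assoc ?Rinv_l; lra.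
have sm : (1 - / L) * saddle L <= Rpower (ln (INR m.+1) / (gamma - 1)) beta.
  apply: (@Rle_trans _ (Rpower ((L - 1) / (gamma - 1)) beta)); last first.
    apply: Rle_Rpower_l; first lra.
    split; first by apply: Rdiv_lt_0_compat; lra.
    apply: Rmult_le_compat_r Lm; left; apply: Rinv_0_lt_compat; lra.
  have u : 0 < 1 - / L <= 1.
    have : 0 < / L <= / 2 by split; [apply: Rinv_0_lt_compat | apply: Rinv_le_contravar]; lra.
    lra.
  have -> : (L - 1) / (gamma - 1) = (1 - / L) * (L / (gamma - 1)) by field; lra.
  rewrite -Rpower_mult_distr; [|lra|by apply: Rdiv_lt_0_compat; lra].
  apply: Rmult_le_compat_r; first lra.
  have lnu : ln (1 - / L) <= 0 by rewrite -ln_1; apply: ln_le; lra.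
  rewrite -{1}(exp_ln (1 - / L)); last lra.
  have : ln (1 - / L) <= beta * ln (1 - / L) by nra.
  by case=> [xy|e]; [left; apply: exp_increasing | right; rewrite /Rpower -e].
have sL : / L * saddle L <= / (gamma - 1).
  have := kappa_saddle L0 => ks.
  apply: (Rmult_le_reg_l L) => //.
  rewrite -Rmult_assoc Rinv_r ?Rmult_1_l; last lra.
  rewrite -[L * _]/(L / (gamma - 1)) -ks; nra.
rewrite -/beta /Rdiv; nra.
Qed.

End ThetaGamma.

(** * The asymptotic formula *)

Lemma ln_INR_unbounded M : exists N : nat, forall n, (N <= n)%N -> (M <= ln (INR n))%R.
Proof.
have [N hN] := INR_unbounded (exp M); exists N => n /ssrnat.leP/le_INR Nn.
rewrite -(ln_exp M); apply: ln_le; first exact: exp_pos.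
lra.
Qed.

Theorem theorem8p1 (gamma : R) (Hgamma : (1 < gamma)%R) (j : nat) (Hj : (1 <= j)%N) :
  forall eps : R, (0 < eps)%R ->
  exists N : nat, forall n : nat, (N <= n)%N ->
    (0 < En_R (theta_gamma gamma) n j)%R /\
    (Rabs (ln (En_R (theta_gamma gamma) n j)
           - INR j * gamma * Rpower (ln (INR n) / (gamma - 1)) ((gamma - 1) / gamma))
     <= eps * Rpower (ln (INR n)) ((gamma - 1) / gamma))%R.
Proof.
move=> eps eps0.
set c := (gamma - 1)%R; set beta := (c / gamma)%R.
have c0 : (0 < c)%R by rewrite /c; lra.
have j0 : (0 < INR j)%R by apply: lt_0_INR; apply/ssrnat.ltP.
have b0 : (0 < beta)%R by apply: Rdiv_lt_0_compat; lra.
set D := Rpower (/ c) beta; have D0 : (0 < D)%R by exact: exp_pos.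
(* Half of the allowed error pays for [j * eta * saddle], where [saddle = D * (ln n) ^ beta]. *)
set eta := (eps / (2 * INR j * D))%R.
have eta0 : (0 < eta)%R by apply: Rdiv_lt_0_compat => //; nra.
have lneta : (0 < ln (1 + eta))%R by rewrite -ln_1; apply: ln_increasing; lra.
set C := ln (theta_gamma gamma j / INR j).
(* Having [kappa >= Q] meets both conditions on [kappa] in [ln_ratio_upper]. *)
set Q := (1 + c / ln (1 + eta))%R.
have Q1 : (1 <= Q)%R.
  by have := Rdiv_lt_0_compat _ _ c0 lneta; rewrite /Q; lra.
(* Once [(ln n) ^ beta >= B], the bounded terms fit into the other half of the error. *)
set B := ((Rabs C + INR j * (1 + gamma / c)) * (2 / eps))%R.
have gc : (0 < gamma / c)%R by apply: Rdiv_lt_0_compat; lra.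
have B0 : (0 < B)%R.
  apply: Rmult_lt_0_compat; last by apply: Rdiv_lt_0_compat; lra.
  by have := Rabs_pos C; nra.
(* The summands secure [ln n >= 2], [kappa >= Q] and [(ln n) ^ beta >= B] in turn. *)
have [N0 hN] := ln_INR_unbounded (2 + c * Rpower Q gamma + Rpower B (/ beta))%R.
exists (maxn N0 j.*2) => n; rewrite geq_max => /andP[/hN hL nj].
set L := ln (INR n) in hL *.
have pQ : (0 < Rpower Q gamma)%R by exact: exp_pos.
have pB : (0 < Rpower B (/ beta))%R by exact: exp_pos.
have cQ : (0 < c * Rpower Q gamma)%R by nra.
have L2 : (2 <= L)%R by lra.
have kapQ : (Q <= Rpower (L / c) (/ gamma))%R.
  have -> : Q = Rpower (Rpower Q gamma) (/ gamma).
    by rewrite Rpower_mult Rinv_r ?Rpower_1; lra.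
  apply: Rle_Rpower_l; first by left; apply: Rinv_0_lt_compat; lra.
  split=> //; apply: (Rmult_le_reg_l c) => //.
  by have -> : (c * (L / c) = L)%R; [field; lra | lra].
have XB : (B <= Rpower L beta)%R.
  have -> : B = Rpower (Rpower B (/ beta)) beta.
    by rewrite Rpower_mult Rinv_l ?Rpower_1; lra.
  by apply: Rle_Rpower_l; lra.
have SX : Rpower (L / c) beta = (D * Rpower L beta)%R.
  rewrite Rpower_mult_distr; [|exact: Rinv_0_lt_compat|lra].
  by rewrite Rmult_comm.
have jn : (j <= n)%N by apply: leq_trans nj; rewrite -addnn leq_addr.
pose theta k : R := (theta_root gamma k ^+ k)%RR.
pose a := exp_coef theta; pose r := exp_coef_ratio theta.
have th0 k : (0 < theta k)%RR by exact: theta_root_pow_gt0.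
have a0 k : (0 < a k)%R by apply/RltP; apply: exp_coef_gt0.
have r0 k : (0 < r k)%R by apply/RltP; apply: exp_coef_ratio_gt0.
have thlc := theta_root_pow_log_concave Hgamma.
have tj : (0 < theta_gamma gamma j / INR j)%R.
  by apply: Rdiv_lt_0_compat => //; exact: exp_pos.
have EE : En_R (theta_gamma gamma) n j = (theta_gamma gamma j / INR j * (a (n - j)%N / a n))%R.
  rewrite (@En_R_exp_coef _ (theta_root gamma)) ?Hj //.
  - by rewrite -INRE.
  - by move=> k; exact: theta_rootE.
  - by rewrite gt_eqF //; apply/RltP/a0.
have qa : (0 < a (n - j)%N / a n)%R by exact: Rdiv_lt_0_compat.
split; first by rewrite EE; exact: Rmult_lt_0_compat.
rewrite EE ln_mult // -/C.
(* The quotient is the product of [r (n - j), ..., r (n - 1)], hence lies between the [j]-th powers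
   of the first and the last. *)
have low : (INR j * ln (r (n - j)%N) <= ln (a (n - j)%N / a n))%R.
  rewrite -ln_pow //; apply: ln_le; first exact: pow_lt.
  apply: (Rmult_le_reg_r (a n)) => //.
  rewrite /Rdiv Rmult_assoc Rinv_l ?Rmult_1_r; last by have := a0 n; lra.
  rewrite RpowE; apply/RleP; rewrite RmultE.
  have := @exp_coef_ratio_lower _ theta erefl th0 thlc (n - j) (n - j) j (leqnn _).
  by rewrite subnK.
have upp : (ln (a (n - j)%N / a n) <= INR j * ln (r n.-1))%R.
  rewrite -ln_pow //; apply: ln_le => //.
  apply: (Rmult_le_reg_r (a n)) => //.
  rewrite /Rdiv Rmult_assoc Rinv_l ?Rmult_1_r; last by have := a0 n; lra.
  rewrite RpowE; apply/RleP; rewrite RmultE.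
  have := @exp_coef_ratio_upper _ theta erefl th0 thlc n.-1 (n - j) j.
  by rewrite subnK // leqSpred => ->.
have n0 : (0 < n)%N by exact: leq_trans Hj jn.
have U : (ln (r n.-1) <= (gamma + eta) * Rpower (L / c) beta + 1)%R.
  have := @ln_ratio_upper gamma Hgamma n.-1 eta eta0; rewrite prednK // -/L -/c -/beta.
  apply; [lra|lra|].
  have e : ((Q - 1) * ln (1 + eta) = c)%R by rewrite /Q; field; lra.
  by rewrite -{1}e; apply: Rmult_le_compat_r; lra.
have W : (gamma * Rpower (L / c) beta - gamma / c - 1 <= ln (r (n - j)%N))%R.
  apply: ln_ratio_lower => //; first 1 last.
  - rewrite doubleS; apply: leq_trans (leqW (leqnSn _)).
    rewrite -(leq_add2r j.*2) -doubleD subnK //.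
    by rewrite -[n.*2]addnn leq_add2l.
  - by rewrite -/L -/c; lra.
  - rewrite subn_gt0; apply: leq_trans nj.
    by rewrite -addnn -[X in (X < _)%N]addn0 ltn_add2l.
set S := Rpower (L / c) beta in SX U W *.
set X := Rpower L beta in XB SX *.
have X0 : (0 < X)%R by exact: exp_pos.
have etaS : (INR j * (eta * S) = eps / 2 * X)%R.
  by rewrite SX /eta; field; lra.
have BX : (Rabs C + INR j * (1 + gamma / c) <= eps / 2 * X)%R.
  have -> : (Rabs C + INR j * (1 + gamma / c) = eps / 2 * B)%R by rewrite /B; field; lra.
  by apply: Rmult_le_compat_l; lra.
have [C1 C2] : (C <= Rabs C /\ - C <= Rabs C)%R.
  by split; [exact: Rle_abs | rewrite -Rabs_Ropp; exact: Rle_abs].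
have U' := Rmult_le_compat_l _ _ _ (Rlt_le _ _ j0) U.
have W' := Rmult_le_compat_l _ _ _ (Rlt_le _ _ j0) W.
have jg : (0 < INR j * (gamma / c))%R by exact: Rmult_lt_0_compat.
apply: Rabs_le; split; nra.
Qed.
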